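(* There exists a property $P$ of graphs such that $P$ is characterizable by the spectrum and such that the decision problem ''given a graph $G$, does $G$ have property $P$?'' is NP-hard.
   Context: Graphs are finite, simple and undirected. A property of graphs is an isomorphism-invariant class of graphs. The spectrum of a graph is the multiset of eigenvalues (with multiplicities) of its adjacency matrix. A property $P$ is characterizable by the spectrum if whether a graph has $P$ is determined by its spectrum, i.e. whenever two graphs $G$ and $G'$ have the same spectrum, $G$ has $P$ if and only if $G'$ has $P$. In the decision problem, graphs are given as input by their adjacency matrices; NP-hardness is with respect to polynomial-time many-one reductions. *)

(* Defs.v *)
From HB Require Import structures.
From mathcomp Require Import all_boot all_algebra all_field.
From mathcomp Require Import finmap multiset.

Set Implicit Arguments.
Unset Strict Implicit.
Unset Printing Implicit Defensive.

Import GRing.Theory.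
Local Open Scope ring_scope.

Record sgraph := SGraph {
  vertex :> finType;
  adj : rel vertex;
  adj_sym : symmetric adj;
  adj_irrefl : irreflexive adj }.

Definition isomorphic (G H : sgraph) : Prop :=
  exists2 f : G -> H, bijective f & forall x y, adj (f x) (f y) = adj x y.

Definition graph_property (P : sgraph -> Prop) : Prop :=
  forall G H, isomorphic G H -> (P G <-> P H).

Definition adjacency_matrix (G : sgraph) : 'M[algC]_#|G| :=
  \matrix_(i, j) (adj (enum_val i) (enum_val j))%:R.

(* The roots of the (monic) characteristic polynomial, each repeated according
   to its multiplicity.  Reordering the vertices conjugates the matrix by a
   permutation, so the enumeration of G underlying it is irrelevant. *)
Definition spectrum (G : sgraph) : {mset algC}%mset :=
  seq_mset (sval (closed_field_poly_normal (char_poly (adjacency_matrix G)))).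

Definition spectrally_characterizable (P : sgraph -> Prop) : Prop :=
  forall G H, spectrum G = spectrum H -> (P G <-> P H).

Inductive move := MoveLeft | Stay | MoveRight.

(* Deterministic Turing machines with tm_extra.+1 two-way infinite tapes over an
   arbitrary finite alphabet.  tm_sym None is the blank; tm_sym (Some b) is the
   symbol for the bit b. *)
Record tm := TM {
  tm_extra : nat;
  tm_state : finType;
  tm_char : finType;
  tm_sym : option bool -> tm_char;
  tm_sym_inj : injective tm_sym;
  tm_start : tm_state;
  tm_halt : tm_state;
  tm_delta : tm_state -> {ffun 'I_tm_extra.+1 -> tm_char} ->
             tm_state * {ffun 'I_tm_extra.+1 -> tm_char * move} }.

(* tleft lists the cells to the left of the head, nearest first; tright those to
   its right, nearest first.  All cells beyond the two lists are blank. *)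
Record tape (C : Type) := Tape { tleft : seq C; tscan : C; tright : seq C }.

Definition tape_move (C : Type) (blank : C) (m : move) (t : tape C) : tape C :=
  let: Tape l c r := t in
  match m with
  | MoveLeft => Tape (behead l) (head blank l) (c :: r)
  | Stay => t
  | MoveRight => Tape (c :: l) (head blank r) (behead r)
  end.

Definition tape_write (C : Type) (c : C) (t : tape C) : tape C :=
  Tape (tleft t) c (tright t).

Section Runs.
Variable M : tm.

Let blank := tm_sym M None.
Let bit b := tm_sym M (Some b).

Record config := Config {
  cstate : tm_state M;
  ctapes : {ffun 'I_(tm_extra M).+1 -> tape (tm_char M)} }.

Definition step (c : config) : config :=
  if cstate c == tm_halt M then c else
  let: (q, a) := tm_delta (cstate c) [ffun i => tscan (ctapes c i)] in
  Config q [ffun i => tape_move blank (a i).2 (tape_write (a i).1 (ctapes c i))].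

Definition input_tape (w : seq bool) : tape (tm_char M) :=
  let s := map bit w in Tape [::] (head blank s) (behead s).

Definition init (w : seq bool) : config :=
  Config (tm_start M) [ffun i => input_tape (if i == ord0 then w else [::])].

(* The output is read on the last tape, from the head rightwards; what is left of
   the head there, and the contents of the other tapes, is disregarded. *)
Definition halts_with (c : config) (w : seq bool) : Prop :=
  cstate c = tm_halt M /\
  exists m, tscan (ctapes c ord_max) :: tright (ctapes c ord_max)
            = map bit w ++ nseq m blank.

End Runs.

(* A configuration in the halting state is fixed by step, so halting within p(n)
   steps is the same as having halted after exactly p(n) steps. *)
Definition polytime (f : seq bool -> seq bool) : Prop :=
  exists (M : tm) (p : {poly nat}), forall w : seq bool,
    halts_with (iter p.[size w] (@step M) (init M w)) (f w).

Definition language := seq bool -> Prop.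

(* Injective: the bits of x are doubled, and the first undoubled pair 01 marks the
   end of x. *)
Definition pair_code (x u : seq bool) : seq bool :=
  flatten [seq [:: b; b] | b <- x] ++ [:: false, true & u].

Definition in_NP (L : language) : Prop :=
  exists (q : {poly nat}) (V : seq bool -> bool),
    polytime (fun w => [:: V w]) /\
    forall x, L x <->
      exists u : seq bool, (size u <= q.[size x])%N /\ V (pair_code x u).

Definition poly_reducible (L1 L2 : language) : Prop :=
  exists2 f : seq bool -> seq bool, polytime f & forall x, L1 x <-> L2 (f x).

Definition NP_hard (L : language) : Prop :=
  forall L', in_NP L' -> poly_reducible L' L.

(* w lists, row after row, the entries of the adjacency matrix of G with respect
   to some ordering s of its vertices. *)
Definition adjacency_code (G : sgraph) (w : seq bool) : Prop :=
  exists2 s : seq G, perm_eq s (enum G) & w = [seq adj x y | x <- s, y <- s].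

(* Words of non-square length, or that are not the matrix of a simple graph, are
   no-instances. *)
Definition graph_problem (P : sgraph -> Prop) : language :=
  fun w => exists2 G : sgraph, adjacency_code G w & P G.

(* Main.v *)
(* For a word v = v_1 ... v_n, put on the vertices (j, c), 0 <= j, c <= n, a
   clique on {(j, c) : c <= j} for every j with v_j = 1.  The positive eigenvalues
   of the resulting graph are the j with v_j = 1, so the spectrum determines v when v ends in 1.  As P need not
   be decidable, let it hold when the positive integer eigenvalues spell a word
   1^i 0 x 1 such that x is in the i-th language of an enumeration of NP.  Then
   every language of NP reduces to P, by the map sending x to the adjacency
   matrix of the graph of 1^i 0 x 1, and this matrix is printed in polynomial
   time by four nested loops over the word. *)

From mathcomp Require Import all_boot all_algebra all_field.
From mathcomp Require Import zify ring.
Require Import Defs.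

Set Implicit Arguments.
Unset Strict Implicit.
Unset Printing Implicit Defensive.

Import GRing.Theory Num.Theory.

(** * Composing Turing machines *)

Section Fragments.
Variables (k : nat) (C : finType) (sym : option bool -> C).
Hypothesis sym_inj : injective sym.

Local Notation blank := (sym None).
Local Notation bit b := (sym (Some b)).
Local Notation index := 'I_k.+1.
Local Notation tapes := {ffun index -> tape C}.
Local Notation scans := {ffun index -> C}.

(** A machine stripped of its symbol encoding, so that programs over the same tapes and alphabet can
    be combined. *)
Record frag := Frag {
  fstate : finType;
  fstart : fstate;
  fhalt : fstate;
  fdelta : fstate -> scans -> fstate * {ffun index -> C * move} }.

Definition machine (F : frag) : tm :=
  TM sym_inj (fstart F) (fhalt F) (@fdelta F).

Definition conf (F : frag) (q : fstate F) (T : tapes) : config (machine F) :=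
  @Config (machine F) q T.

(** The time is only an upper bound, so it may be rounded up when runs are combined. *)
Definition reach (F : frag) (c c' : config (machine F)) (t : nat) : Prop :=
  exists2 s, s <= t & iter s (@step (machine F)) c = c'.

Definition runs (F : frag) (T T' : tapes) (t : nat) : Prop :=
  reach (conf (fstart F) T) (conf (fhalt F) T') t.

Definition scan (T : tapes) : scans := [ffun i => tscan (T i)].

Definition act (a : {ffun index -> C * move}) (T : tapes) : tapes :=
  [ffun i => tape_move blank (a i).2 (tape_write (a i).1 (T i))].

Definition stay (s : scans) : {ffun index -> C * move} :=
  [ffun i => (s i, Stay)].

Lemma act_stay (T : tapes) : act (stay (scan T)) T = T.
Proof. by apply/ffunP => i; rewrite !ffunE /=; case: (T i). Qed.

Lemma step_conf (F : frag) (q : fstate F) (T : tapes) : q != fhalt F ->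
  step (conf q T) =
  conf (fdelta q (scan T)).1 (act (fdelta q (scan T)).2 T).
Proof.
move=> /negPf qh; rewrite /step /= qh.
by rewrite /scan; case: fdelta.
Qed.

Lemma step_halt (F : frag) (T : tapes) :
  step (conf (fhalt F) T) = conf (fhalt F) T.
Proof. by rewrite /step /= eqxx. Qed.

Lemma iter_halt (F : frag) (T : tapes) t :
  iter t (@step (machine F)) (conf (fhalt F) T) = conf (fhalt F) T.
Proof. by elim: t => //= t ->; rewrite step_halt. Qed.

Lemma reach_trans (F : frag) (c1 c2 c3 : config (machine F)) t1 t2 :
  reach c1 c2 t1 -> reach c2 c3 t2 -> reach c1 c3 (t1 + t2).
Proof.
move=> [s1 s1t <-] [s2 s2t <-]; exists (s2 + s1); last by rewrite iterD.
by rewrite addnC leq_add.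
Qed.

Lemma reach_le (F : frag) (c1 c2 : config (machine F)) t1 t2 :
  t1 <= t2 -> reach c1 c2 t1 -> reach c1 c2 t2.
Proof. by move=> t12 [s st <-]; exists s => //; apply: leq_trans t12. Qed.

(** The halting configuration is fixed, so an upper bound on the time becomes an exact iteration
    count, as [polytime] asks. *)
Lemma runs_iter (F : frag) (T T' : tapes) t :
  runs F T T' t ->
  iter t (@step (machine F)) (conf (fstart F) T) = conf (fhalt F) T'.
Proof. by case=> s st E; rewrite -(subnK st) iterD E iter_halt. Qed.

(** Outside the halting state [e] commutes with the transitions, so a run is carried over step by
    step. The halting state of [F] is left out so that a combinator can add its own transition
    there. *)
Lemma reach_embed (F F' : frag) (e : fstate F -> fstate F') :
  (forall q s, q != fhalt F ->
     e q != fhalt F' /\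
     fdelta (e q) s = (e (fdelta q s).1, (fdelta q s).2)) ->
  forall T T' t, runs F T T' t ->
    reach (conf (e (fstart F)) T) (conf (e (fhalt F)) T') t.
Proof.
move=> He T T' t [s st]; move: (fstart F) T.
suff H : forall q T, iter s (@step (machine F)) (conf q T) = conf (fhalt F) T' ->
    reach (conf (e q) T) (conf (e (fhalt F)) T') s.
  by move=> q T /H; apply: reach_le.
elim: s {t st} => [|s IH] q T; first by case=> -> ->; exists 0.
(* [s] may exceed the halting time; the idle steps at [fhalt F] are dropped in [F']. *)
have [->|qh] := eqVneq q (fhalt F).
  by rewrite iter_halt => -[->]; exists 0.
rewrite iterSr step_conf // => /IH; have [e1 e2] := He q (scan T) qh.
move=> H; rewrite -add1n; apply: reach_trans H.
by exists 1 => //=; rewrite step_conf // e2.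
Qed.

Definition actF (a : scans -> {ffun index -> C * move}) : frag :=
  @Frag bool false true (fun _ s => (true, a s)).

Lemma runs_act a (T : tapes) : runs (actF a) T (act (a (scan T)) T) 1.
Proof. by exists 1 => //=; rewrite step_conf. Qed.

Definition seqF (F G : frag) : frag :=
  @Frag (fstate F + fstate G)%type (inl (fstart F)) (inr (fhalt G))
    (fun q s => match q with
     | inl q => if q == fhalt F then (inr (fstart G), stay s)
                else (inl (fdelta q s).1, (fdelta q s).2)
     | inr q => (inr (fdelta q s).1, (fdelta q s).2)
     end).

Lemma runs_seq F G T T' T'' t t' :
  runs F T T' t -> runs G T' T'' t' -> runs (seqF F G) T T'' (t + t').+1.
Proof.
move=> HF HG; rewrite -addnS -add1n.
apply: (@reach_trans _ _ (@conf (seqF F G) (inl (fhalt F)) T')).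
  apply: (@reach_embed F (seqF F G) inl) HF => q s qh.
  by split=> //=; rewrite (negPf qh).
apply: (@reach_trans _ _ (@conf (seqF F G) (inr (fstart G)) T')).
  by exists 1 => //=; rewrite step_conf //= eqxx /= act_stay.
by apply: (@reach_embed G (seqF F G) inr) HG => q s qh; split.
Qed.

(** [inl false] is the state that tests the condition. Testing and returning from the body take one
    step each and leave the tapes alone, hence the [2] per round. *)
Definition whileF (cond : pred scans) (F : frag) : frag :=
  @Frag (bool + fstate F)%type (inl false) (inl true)
    (fun q s => match q with
     | inl _ => (if cond s then inr (fstart F) else inl true, stay s)
     | inr q => if q == fhalt F then (inl false, stay s)
                else (inr (fdelta q s).1, (fdelta q s).2)
     end).

Lemma runs_while0 (cond : pred scans) F T :
  ~~ cond (scan T) -> runs (whileF cond F) T T 1.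
Proof.
by move=> /negPf c; exists 1 => //=; rewrite step_conf //= c act_stay.
Qed.

Lemma runs_whileS (cond : pred scans) F T T' T'' t t' :
  cond (scan T) -> runs F T T' t -> runs (whileF cond F) T' T'' t' ->
  runs (whileF cond F) T T'' (t + 2 + t').
Proof.
move=> c HF; apply: reach_trans; rewrite addn2 -addn1 -add1n -addnA.
apply: (@reach_trans _ _ (@conf (whileF cond F) (inr (fstart F)) T)).
  by exists 1 => //=; rewrite step_conf //= c act_stay.
apply: (@reach_trans _ _ (@conf (whileF cond F) (inr (fhalt F)) T')).
  apply: (@reach_embed F (whileF cond F) inr) HF => q s qh.
  by split=> //=; rewrite (negPf qh).
by exists 1 => //=; rewrite step_conf //= eqxx act_stay.
Qed.

End Fragments.

(** * Loops over tapes that are only read *)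

Section ReadOnlyPhase.
Variables (k : nat) (C : finType) (sym : option bool -> C).
Hypothesis sym_inj : injective sym.

Local Notation blank := (sym None).
Local Notation bit b := (sym (Some b)).
Local Notation index := 'I_k.+1.
Local Notation tapes := {ffun index -> tape C}.
Local Notation scans := {ffun index -> C}.

(** Coordinates relative to the head; they identify tapes whose lists differ only in trailing
    blanks. *)
Definition cell (t : tape C) (z : int) : C :=
  match z with
  | Posz 0 => tscan t
  | Posz n.+1 => nth blank (tright t) n
  | Negz n => nth blank (tleft t) n
  end.

Definition shift (m : move) : int :=
  match m with MoveLeft => -1 | Stay => 0 | MoveRight => 1 end.

Lemma cell_move m t z : cell (tape_move blank m t) z = cell t (z + shift m).
Proof.
case: t => l c r; case: m; rewrite /shift; last 1 first.
- case: z => [n|[|n]].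
  + have -> : (Posz n + 1 = Posz n.+1)%R by lia.
    by case: n => [|n]; case: r => [|x r] /=; rewrite ?nth_nil.
  + by have -> : (Negz 0 + 1 = 0)%R by lia.
  + by have -> : (Negz n.+1 + 1 = Negz n)%R by lia.
- case: z => [[|n]|n].
  + by case: l.
  + have -> : (Posz n.+1 + -1 = Posz n)%R by lia.
    by case: n.
  + have -> : (Negz n + -1 = Negz n.+1)%R by lia.
    by case: l => [|x l] /=; rewrite ?nth_nil.
- by rewrite addr0.
Qed.

Definition opp_move (m : move) : move :=
  match m with MoveLeft => MoveRight | Stay => Stay | MoveRight => MoveLeft end.

Lemma shift_opp m : shift (opp_move m) = (- shift m)%R.
Proof. by case: m. Qed.

Variable U : int -> C.

Definition inner (i : index) : bool := (i != ord0) && (i != ord_max).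

(** All inner tapes carry the same content [U] and differ only in their head positions [h]. The head
    of the last tape stands on the blank just before the output, which grows to the left. *)
Definition at_pos (h : index -> int) (out : seq bool) (T : tapes) : Prop :=
  (forall i, inner i -> forall z, cell (T i) z = U (h i + z)%R) /\
  T ord_max = Tape [::] blank [seq bit b | b <- out].

Definition spec (F : frag k C) h out h' out' (t : nat) : Prop :=
  forall T, at_pos h out T ->
    exists2 T', runs sym_inj F T T' t & at_pos h' out' T'.

Definition go (h : index -> int) (d : index -> move) (z : int) : index -> int :=
  fun i => (h i + z * shift (d i))%R.

Lemma at_pos_ext h h' out T : (forall i, inner i -> h i = h' i) ->
  at_pos h out T -> at_pos h' out T.
Proof. by move=> hh' [H ?]; split=> // i ii z; rewrite H // hh'. Qed.

Lemma at_pos_scan h out T i : at_pos h out T -> inner i -> scan T i = U (h i).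
Proof. by case=> H _ ii; rewrite ffunE -(addr0 (h i)) -H. Qed.

Lemma spec_seq F G h h' h'' out out' out'' t t' :
  spec F h out h' out' t -> spec G h' out' h'' out'' t' ->
  spec (seqF F G) h out h'' out'' (t + t').+1.
Proof.
move=> HF HG T /HF[T' r /HG[T'' r' st]]; exists T'' => //.
exact: runs_seq r r'.
Qed.

Definition moveF (d : index -> move) : frag k C :=
  actF (fun s => [ffun i => (s i, d i)]).

Lemma spec_move d h out : d ord_max = Stay ->
  spec (moveF d) h out (go h d 1) out 1.
Proof.
move=> dmax T [H E]; exists (act sym [ffun i => (scan T i, d i)] T).
  exact: runs_act.
split=> [i ii z|]; rewrite !ffunE; last by rewrite /= dmax E.
have -> : tape_write (tscan (T i)) (T i) = T i by case: (T i).
by rewrite [LHS]cell_move H // /go mul1r -addrA [(z + _)%R]addrC.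
Qed.

Definition nonblank (i : index) : pred scans := fun s => s i != blank.

Section Loop.
Variables (m : nat) (i : index) (d : index -> move).
(** The head of tape [i] thus counts the rounds, and the blank at [m] ends the loop. *)
Hypothesis U_nonblank : forall z : int, (U z != blank) = (0 <= z < m%:Z)%R.
Hypotheses (ii : inner i) (di : d i = MoveRight) (dmax : d ord_max = Stay).

(** One move back from cell [m], a walk back to the blank at [-1], then one move forward. The other
    heads retrace their moves along with head [i]. *)
Definition rewindF : frag k C :=
  seqF (moveF (opp_move \o d))
    (seqF (whileF (nonblank i) (moveF (opp_move \o d))) (moveF d)).

Lemma spec_rewind h out : h i = 0%R ->
  spec rewindF (go h d m) out h out (m * 3 + 5).
Proof.
move=> hi.
have back z : spec (moveF (opp_move \o d)) (go h d z) out (go h d (z - 1)) out 1.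
  move=> T /(@spec_move (opp_move \o d)) []; first by rewrite /= dmax.
  move=> T' r st; exists T' => //; apply: at_pos_ext st => j _.
  by rewrite /go /= shift_opp; ring.
have loop n : n <= m ->
    spec (whileF (nonblank i) (moveF (opp_move \o d)))
      (go h d (n%:Z - 1)) out (go h d (- 1)) out (n * 3 + 1).
  elim: n => [|n IH] nm T st.
    exists T; last by apply: at_pos_ext st.
    apply: runs_while0; rewrite /nonblank (at_pos_scan st ii) U_nonblank.
    by rewrite /go hi di /=; lia.
  have [T' r st'] := back _ _ st.
  have [|T'' r' st''] := IH (ltnW nm) T'.
    by apply: at_pos_ext st' => j _; rewrite /go; congr (_ + _ * _)%R; lia.
  exists T'' => //; rewrite mulSn -addnA.
  apply: runs_whileS r r'.
  by rewrite /nonblank (at_pos_scan st ii) U_nonblank /go hi di /=; lia.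
have -> : m * 3 + 5 = (1 + (m * 3 + 1 + 1).+1).+1 by lia.
apply: spec_seq (back m) _; apply: spec_seq (loop m (leqnn m)) _ => T.
move=> /(@spec_move d)[] // T' r st; exists T' => //.
by apply: at_pos_ext st => j _; rewrite /go; ring.
Qed.

Definition loopF (body : frag k C) : frag k C :=
  seqF (whileF (nonblank i) (seqF body (moveF d))) rewindF.

(** Blocks are put in front of the output, so the last round comes first. A round costs [t + 4]
    steps, and [3] more for its share of the rewind. *)
Lemma spec_loop h out body (e : nat -> seq bool) t : h i = 0%R ->
  (forall x out, x < m ->
     spec body (go h d x) out (go h d x) (e x ++ out) t) ->
  spec (loopF body) h out h
    (flatten [seq e x | x <- rev (iota 0 m)] ++ out) (m * (t + 7) + 7).
Proof.
move=> hi Hbody.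
have loop n x out' : x + n = m ->
    spec (whileF (nonblank i) (seqF body (moveF d)))
      (go h d x) out' (go h d m)
      (flatten [seq e x | x <- rev (iota x n)] ++ out') (n * (t + 4) + 1).
  elim: n x out' => [|n IH] x out' xn T st.
    rewrite -xn addn0; exists T => //.
    apply: runs_while0; rewrite /nonblank (at_pos_scan st ii) U_nonblank.
    by rewrite /go hi di /=; lia.
  have xm : x < m by lia.
  have [T1 r1 st1] := spec_seq (Hbody x out' xm) (@spec_move d _ _ dmax) st.
  have [||T2 r2 st2] := IH x.+1 (e x ++ out') _ T1; first by lia.
    apply: at_pos_ext st1 => j _; rewrite /go.
    by rewrite -addn1 PoszD; ring.
  exists T2; last first.
    by rewrite /= rev_cons map_rcons flatten_rcons -catA.
  have -> : n.+1 * (t + 4) + 1 = (t + 1).+1 + 2 + (n * (t + 4) + 1) by lia.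
  apply: runs_whileS r1 r2.
  by rewrite /nonblank (at_pos_scan st ii) U_nonblank /go hi di /=; lia.
have -> : m * (t + 7) + 7 = (m * (t + 4) + 1 + (m * 3 + 5)).+1 by lia.
apply: spec_seq; last exact: spec_rewind.
move=> T st; apply: (loop m 0 out) => //.
by apply: at_pos_ext st => j _; rewrite /go mul0r addr0.
Qed.

End Loop.

Definition emitF (b : pred scans) : frag k C :=
  actF (fun s => [ffun i =>
    if i == ord_max then (bit (b s), MoveLeft) else (s i, Stay)]).

Lemma spec_emit (b : pred scans) x h out :
  (forall s : scans, (forall i, inner i -> s i = U (h i)) -> b s = x) ->
  spec (emitF b) h out h (x :: out) 1.
Proof.
move=> Hb T st; exists (act sym
    [ffun i => if i == ord_max then (bit (b (scan T)), MoveLeft)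
               else (scan T i, Stay)] T); first exact: runs_act.
have {}Hb : b (scan T) = x by apply: Hb => i; apply: at_pos_scan st.
case: st => H E; split=> [i ii z|]; rewrite !ffunE.
  have /negPf -> : i != ord_max by case/andP: ii.
  by rewrite -H // ffunE; case: (T i).
by rewrite eqxx /= E Hb.
Qed.

End ReadOnlyPhase.

(** * Printing the adjacency matrix *)

Section Setup.
Variables (k : nat) (C : finType) (sym : option bool -> C).
Hypothesis sym_inj : injective sym.

Local Notation blank := (sym None).
Local Notation bit b := (sym (Some b)).
Local Notation index := 'I_k.+2.
Local Notation tapes := {ffun index -> tape C}.

(** [s] is the unread input; [r] has been written on every inner tape, and is reversed because
    [tleft] lists the nearest cell first. *)
Definition written (l : seq C) (s : seq bool) (r : seq C) (T : tapes) : Prop :=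
  [/\ T ord0 = Tape l (head blank [seq bit b | b <- s])
                      (behead [seq bit b | b <- s]),
      T ord_max = Tape [::] blank [::] &
      forall i, inner i -> T i = Tape (rev r) blank [::]].

Definition writeF (x : C) : frag k.+1 C :=
  actF (fun s => [ffun i => if inner i then (x, MoveRight) else (s i, Stay)]).

Lemma runs_write x l s r T : written l s r T ->
  exists2 T', runs sym_inj (writeF x) T T' 1 & written l s (rcons r x) T'.
Proof.
case=> T0 Tmax Ti; eexists; first exact: runs_act.
split; rewrite ?ffunE /inner ?eqxx ?andbF /=.
- by rewrite ?ffunE T0.
- by rewrite ?ffunE Tmax.
by move=> i ii; rewrite !ffunE /inner in ii *; rewrite ii /= Ti //= rev_rcons.
Qed.

Definition copyF : frag k.+1 C :=
  actF (fun s => [ffun i => if inner i then (s ord0, MoveRight)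
    else (s i, if i == ord0 then MoveRight else Stay)]).

Lemma runs_copy b l s r T : written l (b :: s) r T ->
  exists2 T', runs sym_inj copyF T T' 1 &
    written (bit b :: l) s (rcons r (bit b)) T'.
Proof.
case=> T0 Tmax Ti; eexists; first exact: runs_act.
split; rewrite ?ffunE /inner ?eqxx ?andbF /=.
- by rewrite ?ffunE T0.
- by rewrite ?ffunE Tmax.
move=> i ii; rewrite !ffunE /inner in ii *.
by rewrite ii /= ?T0 Ti //= rev_rcons.
Qed.

Definition wordF (u : seq C) : frag k.+1 C :=
  foldr (fun x F => seqF (writeF x) F) (actF (@stay k.+1 C)) u.

Lemma runs_word u l s r T : written l s r T ->
  exists2 T', runs sym_inj (wordF u) T T' (size u * 2 + 1) &
    written l s (r ++ u) T'.
Proof.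
elim: u r T => [|x u IH] r T wT /=.
  by exists T; rewrite ?cats0 // -{2}(act_stay sym T); apply: runs_act.
have [T1 r1 /IH[T2 r2 w2]] := runs_write x wT.
exists T2; last by rewrite -cat_rcons.
have -> : (size u).+1 * 2 + 1 = (1 + (size u * 2 + 1)).+1 by lia.
exact: runs_seq r1 r2.
Qed.

Lemma runs_copies l s r T : written l s r T ->
  exists2 T', runs sym_inj (whileF (nonblank sym ord0) copyF) T T'
                (size s * 3 + 1) &
    written (rev [seq bit b | b <- s] ++ l) [::] (r ++ [seq bit b | b <- s]) T'.
Proof.
elim: s l r T => [|b s IH] l r T wT.
  exists T; last by rewrite cats0.
  by apply: runs_while0; case: wT => T0 _ _; rewrite /nonblank ffunE T0 /= eqxx.
have [T1 r1 /IH[T2 r2 w2]] := runs_copy wT; exists T2.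
  rewrite /= mulSn -addnA.
  apply: runs_whileS r1 r2; case: wT => T0 _ _.
  by rewrite /nonblank ffunE T0 /= (inj_eq sym_inj).
by move: w2; rewrite /= rev_cons !cat_rcons.
Qed.

Definition setupF (u : seq C) (v : seq bool) : frag k.+1 C :=
  seqF (wordF u) (seqF (whileF (nonblank sym ord0) copyF)
                       (wordF [seq bit b | b <- v])).

Lemma runs_setup u v l s T : written l s [::] T ->
  exists T' l', runs sym_inj (setupF u v) T T'
                  (size u * 2 + size s * 3 + size v * 2 + 5) /\
    written l' [::] (u ++ [seq bit b | b <- s ++ v]) T'.
Proof.
move=> /(runs_word u)[T1 r1 /runs_copies[T2 r2]].
move=> /(runs_word [seq bit b | b <- v])[T3 r3 w3]; exists T3.
eexists; split; last by rewrite map_cat catA; apply: w3.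
have -> : size u * 2 + size s * 3 + size v * 2 + 5 =
  (size u * 2 + 1 + (size s * 3 + 1 + (size [seq bit b | b <- v] * 2 + 1)).+1).+1.
  by rewrite size_map; lia.
by apply: runs_seq r1 _; apply: runs_seq r2 r3.
Qed.

End Setup.

(** The prefixed [false] makes the first bit of [v] belong to [j = 1] and leaves row [0] without
    edges. *)
Definition clique_edge (v : seq bool) (x y : nat * nat) : bool :=
  [&& x.1 == y.1, nth false (false :: v) x.1,
      x.2 != y.2, x.2 <= x.1 & y.2 <= y.1].

(* The output is written from right to left, hence the decreasing order. *)
Definition countdown (v : seq bool) : seq nat := rev (iota 0 (size v).+1).

Definition vertices (v : seq bool) : seq (nat * nat) :=
  [seq (j, c) | j <- countdown v, c <- countdown v].

Definition matrix_word (v : seq bool) : seq bool :=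
  [seq clique_edge v x y | x <- vertices v, y <- vertices v].

(** Turns an enumeration of pairs into two nested loops; applied to both vertices of an entry, it
    yields the four loops of the machine. *)
Lemma flatten_allpairs (S T R : Type) (g : S * T -> seq R) s t :
  flatten [seq g x | x <- [seq (a, b) | a <- s, b <- t]] =
  flatten [seq flatten [seq g (a, b) | b <- t] | a <- s].
Proof.
by elim: s => //= a s IH; rewrite map_cat flatten_cat IH -map_comp.
Qed.

(** * The machine that prints the matrix *)

Section Printer.

Definition symbol : finType := option (option bool).
Let sym : option bool -> symbol := Some.
(* The blank is [sym None = Some None]; hash is the one symbol outside sym. *)
Let hash : symbol := None.
Let sym_inj : injective sym. Proof. by move=> a b []. Qed.

Local Notation tp n := (@Ordinal 10 n isT).

(* Tapes 1-4 carry the loop counters j, c, j', c'; the heads of tapes 5-8 stand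
   at j - j', c - c', j - c and j' - c', so that on a tape that starts with hash
   equality is read off as hash, and <= as a nonblank symbol. *)
Definition dirs (s : seq move) (i : 'I_10) : move := nth Stay s i.
Let R := MoveRight.
Let L := MoveLeft.
Let S := Stay.
Definition dj := dirs [:: S; R; S; S; S; R; S; R; S; S].
Definition dc := dirs [:: S; S; R; S; S; S; R; L; S; S].
Definition dj' := dirs [:: S; S; S; R; S; L; S; S; R; S].
Definition dc' := dirs [:: S; S; S; S; R; S; L; S; L; S].
Definition dall := dirs [:: S; R; R; R; R; R; R; R; R; S].

Definition edge_test (s : {ffun 'I_10 -> symbol}) : bool :=
  [&& s (tp 5) == hash, s (tp 1) == sym (Some true), s (tp 6) != hash,
      s (tp 7) != sym None & s (tp 8) != sym None].

(** The setup leaves the inner heads just past the word, hence the rewind of all of them. The last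
    move takes the output head from the blank onto the first output bit. *)
Definition printF (c : seq bool) : frag 9 symbol :=
  seqF (setupF 8 sym (hash :: [seq sym (Some b) | b <- c]) [:: true])
  (seqF (rewindF sym (tp 1) dall)
  (seqF (loopF sym (tp 1) dj (loopF sym (tp 2) dc
          (loopF sym (tp 3) dj' (loopF sym (tp 4) dc'
            (emitF sym edge_test)))))
  (moveF symbol (fun i : 'I_10 => if i == ord_max then MoveRight else Stay)))).

Section Run.
Variable v : seq bool.
Let m := (size v).+1.
Definition content (z : int) : symbol :=
  if z is Posz n then nth (sym None) (hash :: [seq sym (Some b) | b <- v]) n
  else sym None.

Lemma content_nonblank z : (content z != sym None) = (0 <= z < m%:Z)%R.
Proof.
case: z => [[|n]|n] //=; rewrite -/sym.
have [nv|nv] := ltnP n (size v).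
  by rewrite (nth_map false) // /m; lia.
by rewrite nth_default ?size_map // eqxx /m; lia.
Qed.

Lemma content_hash z : (content z == hash) = (z == 0)%R.
Proof.
case: z => [[|n]|n] //=.
have [nv|nv] := ltnP n (size v); first by rewrite (nth_map false).
by rewrite nth_default ?size_map.
Qed.

Lemma content_true (n : nat) :
  (content n == sym (Some true)) = nth false (false :: v) n.
Proof.
case: n => [|n] //=.
have [nv|nv] := ltnP n (size v); last by rewrite !nth_default ?size_map.
by rewrite (nth_map false) //; case: nth.
Qed.

Definition loop_time (t : nat) : nat := m * (t + 7) + 7.

Let zero (i : 'I_10) : int := 0%R.

Lemma spec_print :
  spec sym_inj content
    (loopF sym (tp 1) dj (loopF sym (tp 2) dc
          (loopF sym (tp 3) dj' (loopF sym (tp 4) dc' (emitF sym edge_test)))))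
    zero [::] zero (matrix_word v) (iter 4 loop_time 1).
Proof.
have -> : matrix_word v = flatten [seq flatten [seq flatten [seq flatten [seq
    [:: clique_edge v (j, c) (j', c')] | c' <- countdown v] | j' <- countdown v]
    | c <- countdown v] | j <- countdown v] ++ [::].
  rewrite /matrix_word cats0 flatten_allpairs.
  congr flatten; apply: eq_map => j; congr flatten; apply: eq_map => c.
  by rewrite -(flatten_allpairs (fun y => [:: clique_edge v (j, c) y]))
       flatten_map1.
apply: spec_loop => //; first exact: content_nonblank.
move=> j out jm; apply: spec_loop => //; first exact: content_nonblank.
  by rewrite /go /zero /=; lia.
move=> c {}out _; apply: spec_loop => //; first exact: content_nonblank.
  by rewrite /go /zero /=; lia.
move=> j' {}out j'm; apply: spec_loop => //; first exact: content_nonblank.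
  by rewrite /go /zero /=; lia.
move=> c' {}out _; apply: spec_emit => s Hs.
(* The tests on tapes 5 to 8 become conditions on differences of counters; as [j] and [j'] are below
   [m], nonblank means nonnegative on tapes 7 and 8. *)
rewrite /edge_test !Hs // !content_hash !content_nonblank.
have -> : go (go (go (go zero dj j) dc c) dj' j') dc' c' (tp 1) = Posz j.
  by rewrite /go /zero /=; lia.
rewrite content_true /clique_edge /go /zero /=.
by congr (_ && (_ && (_ && (_ && _)))); rewrite /m; lia.
Qed.

End Run.

Definition print_time (a n : nat) : nat :=
  let m := n + a + 2 in
  a * 2 + n * 3 + (m * 3 + iter 4 (fun t => m * (t + 7) + 7) 1) + 18.

Lemma halts_print (c w : seq bool) :
  let M := machine sym_inj (printF c) in
  @halts_with M (iter (print_time (size c) (size w)) (@step M) (init M w))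
    (matrix_word (c ++ w ++ [:: true])).
Proof.
move=> M; set v := c ++ w ++ [:: true]; set m := (size v).+1.
pose T0 : {ffun 'I_10 -> tape symbol} := ctapes (init M w).
have w0 : written sym [::] w [::] T0.
  split; rewrite ?ffunE ?eqxx //.
  by move=> i /andP[/negPf i0 _]; rewrite ffunE i0.
have [T1 [l [r1 w1]]] :=
  runs_setup sym_inj (hash :: [seq sym (Some b) | b <- c]) [:: true] w0.
pose zero (i : 'I_10) : int := 0%R.
(* The setup leaves every inner head at cell [m], just after the [m] symbols of hash and [v]. *)
have st1 : at_pos sym (content v) (go zero dall m) [::] T1.
  case: w1 => _ Tmax Ti; split=> // i ii z; rewrite Ti //.
  have -> : go zero dall m i = Posz m.
    rewrite /go /zero add0r.
    by case: i ii => -[|[|[|[|[|[|[|[|[|[|?]]]]]]]]]] //= ? _; rewrite mulr1.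
  rewrite cat_cons -map_cat -/v.
  have sU : size (hash :: [seq sym (Some b) | b <- v]) = m.
    by rewrite /= size_map.
  case: z => [n|n].
    have -> : cell sym (Tape (rev (hash :: [seq sym (Some b) | b <- v]))
                (sym None) [::]) (Posz n) = sym None.
      by case: n => //= n; rewrite nth_nil.
    by rewrite -PoszD /content nth_default // sU leq_addr.
  (* [Negz n] is the cell [n + 1] places left of the head, at absolute position [m - (n + 1)]. *)
  rewrite /cell /=.
  have [nm|mn] := ltnP n m.
    rewrite nth_rev sU // /content.
    by have -> : (m%:Z + Negz n = (m - n.+1)%:Z)%R by lia.
  rewrite nth_default ?size_rev ?sU //.
  by have -> : (m%:Z + Negz n = Negz (n - m))%R by lia.
have [T2 r2 st2] := spec_rewind sym_inj (@content_nonblank v) (i := tp 1)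
  (d := dall) isT erefl erefl (h := zero) erefl st1.
have [T3 r3 [_ Tmax]] := spec_print st2.
have r4 := runs_act sym_inj (fun s => [ffun i =>
  (s i, if i == ord_max then MoveRight else Stay)]) T3.
have r := runs_seq r1 (runs_seq r2 (runs_seq r3 r4)).
have le_time : (size (hash :: [seq sym (Some b) | b <- c]) * 2 + size w * 3
   + size [:: true] * 2 + 5 + (m * 3 + 5 + (iter 4 (loop_time v) 1 + 1).+1).+1).+1
   <= print_time (size c) (size w).
  rewrite /print_time /loop_time -/m.
  have -> : size w + size c + 2 = m by rewrite /m /v !size_cat /=; lia.
  by rewrite /= size_map; lia.
set T4 := act sym _ T3 in r4 r.
have -> : iter (print_time (size c) (size w)) (@step M) (init M w) =
  conf sym_inj (fhalt (printF c)) T4 := runs_iter (reach_le le_time r).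
split=> //; rewrite /= /T4 !ffunE Tmax.
(* For an empty output the scanned cell is itself one blank, hence the witness [1]. *)
by case: (matrix_word v) => [|b u] /=; [exists 1 | exists 0; rewrite cats0].
Qed.

Lemma polytime_matrix_word (c : seq bool) :
  polytime (fun w => matrix_word (c ++ w ++ [:: true])).
Proof.
pose a := (size c)%:P%R : {poly nat}; pose m : {poly nat} := ('X + a + 2%:P)%R.
pose body (t : {poly nat}) : {poly nat} := (m * (t + 7%:P) + 7%:P)%R.
exists (machine sym_inj (printF c)).
exists (a * 2%:P + 'X * 3%:P + (m * 3%:P + iter 4 body 1) + 18%:P)%R => w.
have body_time t :
    ((body t).[size w] = (size w + size c + 2) * (t.[size w] + 7) + 7)%R.
  by rewrite /body /m /a !(hornerD, hornerM, hornerC, hornerX).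
have -> : (a * 2%:P + 'X * 3%:P + (m * 3%:P + iter 4 body 1) + 18%:P).[size w]%R
    = print_time (size c) (size w); last exact: halts_print.
have iter_time n : (iter n body 1).[size w]%R = iter n (fun t =>
    (size w + size c + 2) * (t + 7) + 7) 1.
  elim: n => [|n IH]; first by rewrite hornerC.
  by rewrite !iterS body_time IH.
(* The iterated polynomial is generalized so that the evaluation laws act only on the outer
   terms. *)
rewrite /print_time; move: (iter_time 4); move: (iter 4 body _) => p pt.
by rewrite /m /a !(hornerD, hornerM, hornerC, hornerX) pt.
Qed.

End Printer.

(** * Enumerating NP *)

Lemma pickle_inj (T : countType) : injective (@pickle T).
Proof. exact: pcan_inj pickleK. Qed.

(** [option bool] encodes the moves in a finite type, so that a transition table is a countable
    datum. *)
Definition move_of (o : option bool) : move :=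
  match o with
  | Some false => MoveLeft | None => Stay | Some true => MoveRight
  end.

Definition of_move (m : move) : option bool :=
  match m with
  | MoveLeft => Some false | Stay => None | MoveRight => Some true
  end.

Lemma of_moveK : cancel of_move move_of.
Proof. by case. Qed.

(* Restricting states and characters to initial segments of nat loses no language
   and leaves only countably many verifiers. *)
Record verifier := Verifier {
  vtapes : nat;
  vstates : nat;
  vchars : nat;
  vsym : {ffun option bool -> 'I_vchars};
  vsym_inj : injectiveb vsym;
  vstart : 'I_vstates;
  vhalt : 'I_vstates;
  vdelta : {ffun 'I_vstates * {ffun 'I_vtapes.+1 -> 'I_vchars} ->
            'I_vstates * {ffun 'I_vtapes.+1 -> 'I_vchars * option bool}};
  vbound : {poly nat};
  vtime : {poly nat} }.

Definition verifier_tm (D : verifier) : tm :=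
  TM (injectiveP _ (vsym_inj D)) (vstart D) (vhalt D)
    (fun q s => let r := vdelta D (q, s) in
       (r.1, [ffun i => ((r.2 i).1, move_of (r.2 i).2)])).

(** The clock [p] makes this meaningful for every machine, whether or not it halts in time. *)
Definition accepts (M : tm) (q p : {poly nat}) (x : seq bool) : Prop :=
  exists u : seq bool, size u <= q.[size x]%R /\
    halts_with (iter p.[size (pair_code x u)]%R (@step M)
                  (init M (pair_code x u))) [:: true].

(** Components whose types depend on the sizes are first pickled to numbers, so that the tuple has a
    fixed type. *)
Definition verifier_code (D : verifier) : nat :=
  pickle (vtapes D, vstates D, vchars D,
          (pickle (vsym D), pickle (vstart D), pickle (vhalt D)),
          pickle (vdelta D),
          (polyseq (vbound D), polyseq (vtime D))).

Lemma verifier_code_inj : injective verifier_code.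
Proof.
move=> [k s a sym inj st h d q p] [k' s' a' sym' inj' st' h' d' q' p'].
(* The sizes are equated first: only then do the other components have equal types. *)
move=> /pickle_inj[] /= ? ? ?; subst k' s' a'.
move=> /pickle_inj ? /pickle_inj ? /pickle_inj ? /pickle_inj ? /val_inj ? /val_inj ?.
by subst sym' st' h' d' q' p'; rewrite (eq_irrelevance inj inj').
Qed.

(** * Renaming states and characters as ordinals *)

Section Standardization.
Variable M : tm.
Local Notation Q := (tm_state M).
Local Notation C := (tm_char M).
Local Notation k := (tm_extra M).

Let sym' := [ffun o => enum_rank (tm_sym M o)].

Lemma sym'_inj : injectiveb sym'.
Proof.
apply/injectiveP => x y; rewrite !ffunE => /enum_rank_inj; exact: tm_sym_inj.
Qed.

Definition standard (q p : {poly nat}) : verifier :=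
  Verifier sym'_inj (enum_rank (tm_start M)) (enum_rank (tm_halt M))
    [ffun qs : 'I_#|Q| * {ffun 'I_k.+1 -> 'I_#|C|} =>
       let r := tm_delta (enum_val qs.1) [ffun i => enum_val (qs.2 i)] in
       (enum_rank r.1, [ffun i => (enum_rank (r.2 i).1, of_move (r.2 i).2)])]
    q p.

Variables q p : {poly nat}.
Let M' := verifier_tm (standard q p).

Definition standard_tape (t : tape C) : tape (tm_char M') :=
  Tape [seq enum_rank c | c <- tleft t] (enum_rank (tscan t))
       [seq enum_rank c | c <- tright t].

Definition standard_config (c : config M) : config M' :=
  @Config M' (enum_rank (cstate c)) [ffun i => standard_tape (ctapes c i)].

Lemma standard_step c : step (standard_config c) = standard_config (step c).
Proof.
rewrite /step [cstate _ in LHS]/= (inj_eq enum_rank_inj).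
case: ifP => // _; rewrite /= ffunE /= enum_rankK.
have -> : [ffun i => enum_val ([ffun j => tscan
    ([ffun l => standard_tape (ctapes c l)] j)] i)] =
    [ffun i => tscan (ctapes c i)].
  by apply/ffunP => i; rewrite !ffunE /= enum_rankK.
case: tm_delta => q' b; congr Config; apply/ffunP => i.
by rewrite !ffunE /= of_moveK; case: (b i) (ctapes c i) => ? [] [[|? ?] ? [|? ?]].
Qed.

Lemma standard_init w : init M' w = standard_config (init M w).
Proof.
have sE b : tm_sym M' b = enum_rank (tm_sym M b) by rewrite /= ffunE.
have inputE u : input_tape M' u = standard_tape (input_tape M u).
  rewrite /input_tape sE.
  have -> : [seq tm_sym M' (Some b) | b <- u] =
      [seq enum_rank c | c <- [seq tm_sym M (Some b) | b <- u]].
    by rewrite -map_comp; apply: eq_map => b; rewrite sE.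
  by case: u.
by congr Config; apply/ffunP => i; rewrite !ffunE inputE.
Qed.

Lemma standard_halts c w : halts_with (standard_config c) w <-> halts_with c w.
Proof.
have sE b : tm_sym M' b = enum_rank (tm_sym M b) by rewrite /= ffunE.
have E n : [seq tm_sym M' (Some b) | b <- w] ++ nseq n (tm_sym M' None) =
    [seq enum_rank c | c <- [seq tm_sym M (Some b) | b <- w] ++
                            nseq n (tm_sym M None)].
  rewrite map_cat map_nseq -map_comp sE; congr (_ ++ _).
  by apply: eq_map => b; rewrite sE.
rewrite /halts_with /= ffunE; split=> -[hc [n tn]]; split.
- exact: enum_rank_inj hc.
- by exists n; apply: (inj_map enum_rank_inj); rewrite -E -tn.
- by rewrite hc.
- by exists n; rewrite E -tn.
Qed.

Lemma standard_accepts x : accepts M' q p x <-> accepts M q p x.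
Proof.
have iterE n c : iter n (@step M') (standard_config c) =
    standard_config (iter n (@step M) c).
  by elim: n => //= n ->; rewrite standard_step.
by split=> -[u [su]]; rewrite ?standard_init ?iterE => hu; exists u; split=> //;
   move: hu; rewrite ?standard_init ?iterE standard_halts.
Qed.

End Standardization.

(** An index that codes no verifier gives the empty language; the reduction uses that every language
    in NP occurs. *)
Definition NP_language (i : nat) (x : seq bool) : Prop :=
  exists2 D, verifier_code D = i & accepts (verifier_tm D) (vbound D) (vtime D) x.

Lemma NP_languageP (L : language) : in_NP L ->
  exists i, forall x, L x <-> NP_language i x.
Proof.
case=> q [V [[M [p MV]] LV]]; exists (verifier_code (standard M q p)) => x.
(* The code determines the verifier, so only [standard M q p] has to be considered. *)
have -> : NP_language (verifier_code (standard M q p)) x <-> accepts M q p x.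
  rewrite -standard_accepts; split; last by exists (standard M q p).
  by case=> D /verifier_code_inj ->.
rewrite LV; split=> -[u [su hu]]; exists u; split=> //.
  by rewrite -hu.
(* The output begins both with the value of [V] and with [true], and [tm_sym] is injective. *)
have [_ [n]] := MV (pair_code x u); case: hu => _ [n' ->] /=.
by case=> /(tm_sym_inj (t := M))[<-].
Qed.

(** * Eigenvalues *)

Local Open Scope ring_scope.

Definition is_eigenvalue (G : sgraph) (a : algC) : bool :=
  eigenvalue (adjacency_matrix G) a.

(** Row vectors over an enumeration become functions on the vertices, the form in which eigenvectors
    of cliques are handled. *)
Lemma is_eigenvalueP (G : sgraph) (a : algC) :
  is_eigenvalue G a <->
  exists2 f : G -> algC, (exists x, f x != 0) &
    forall y, \sum_(x | adj x y) f x = a * f y.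
Proof.
have sum_col (u : 'rV_#|G|) y : \sum_(x | adj x y) u 0 (enum_rank x) =
    (u *m adjacency_matrix G) 0 (enum_rank y).
  rewrite mxE [RHS](reindex enum_rank); last exact/onW_bij/enum_rank_bij.
  rewrite big_mkcond; apply: eq_bigr => x _; rewrite mxE !enum_rankK.
  by case: (adj x y); rewrite (mulr1, mulr0).
split=> [/eigenvalueP[u uA /rV0Pn[i ui]]|[f [x fx] fA]].
  exists (fun x => u 0 (enum_rank x)).
    by exists (enum_val i); rewrite enum_valK.
  by move=> y; rewrite sum_col uA mxE.
apply/eigenvalueP; exists (\row_i f (enum_val i)).
  apply/rowP => j; rewrite -(enum_valK j) -sum_col !mxE enum_rankK -fA.
  by apply: eq_bigr => y _; rewrite mxE enum_rankK.
by apply/rV0Pn; exists (enum_rank x); rewrite mxE enum_rankK.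
Qed.

(** The members of the spectrum are the roots of the characteristic polynomial, that is, the
    eigenvalues. *)
Lemma spectrum_eigenvalue (G H : sgraph) (a : algC) :
  spectrum G = spectrum H -> is_eigenvalue G a = is_eigenvalue H a.
Proof.
have mem_spectrum (K : sgraph) : is_eigenvalue K a =
    (a \in sval (closed_field_poly_normal (char_poly (adjacency_matrix K)))).
  rewrite /is_eigenvalue eigenvalue_root_char.
  case: closed_field_poly_normal => r /= {1}->.
  by rewrite (monicP (char_poly_monic _)) scale1r root_prod_XsubC.
by rewrite !mem_spectrum => /multiset.eq_seq_msetP/perm_mem ->.
Qed.

Lemma isomorphic_sym (G H : sgraph) : isomorphic G H -> isomorphic H G.
Proof.
case=> f [g fK gK] fadj; exists g; first by exists f.
by move=> x y; rewrite -fadj !gK.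
Qed.

Lemma isomorphic_eigenvalue (G H : sgraph) (a : algC) :
  isomorphic G H -> is_eigenvalue G a = is_eigenvalue H a.
Proof.
suff imp (K L : sgraph) : isomorphic K L -> is_eigenvalue L a -> is_eigenvalue K a.
  by move=> GH; apply/idP/idP; apply: imp => //; apply: isomorphic_sym.
case=> f fbij fadj /is_eigenvalueP[u [y uy] uA]; apply/is_eigenvalueP.
have [g fK gK] := fbij; exists (u \o f); first by exists (g y); rewrite /= gK.
move=> x; rewrite /= -uA [RHS](reindex f); last exact: onW_bij.
by apply: eq_bigl => z; rewrite fadj.
Qed.

(** The isomorphism matches vertices at equal positions in the two orderings; [y0] serves as the
    default of [nth]. *)
Lemma adjacency_code_isomorphic (G H : sgraph) (y0 : H) w :
  adjacency_code G w -> adjacency_code H w -> isomorphic G H.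
Proof.
case=> s sG -> [t tH] E.
have us : uniq s by rewrite (perm_uniq sG) enum_uniq.
have ut : uniq t by rewrite (perm_uniq tH) enum_uniq.
have ms x : x \in s by rewrite (perm_mem sG) mem_enum.
(* The length of the word is the square of the number of vertices. *)
have sizes : size s = size t.
  by have /(congr1 size) := E; rewrite !size_allpairs; nia.
(* Equal row lengths allow the flat word to be cut back into rows. *)
have {}E : [seq [seq adj x y | y <- s] | x <- s] =
           [seq [seq adj x y | y <- t] | x <- t].
  apply: eq_from_flatten_shape => //.
  rewrite /shape -!map_comp; apply: (@eq_from_nth _ 0%N); rewrite ?size_map //.
  move=> i si; have x0 : G by case: (s) si.
  by rewrite (nth_map x0) // (nth_map y0) -?sizes //= !size_map.
have idx x : (index x s < size t)%N by rewrite -sizes index_mem.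
exists (fun x => nth y0 t (index x s)).
  apply: inj_card_bij.
    move=> x y /eqP; rewrite nth_uniq // => /eqP; exact: index_inj.
  by rewrite !cardE -(perm_size sG) -(perm_size tH) sizes.
move=> x y; have := congr1 (fun m => nth false (nth [::] m (index x s)) (index y s)) E.
rewrite (nth_map x) ?index_mem // (nth_map y) ?index_mem // !nth_index //.
by rewrite (nth_map y0) // (nth_map y0).
Qed.

(** * The clique graph of a word and its positive integer eigenvalues *)

Section CliqueGraph.
Variable v : seq bool.
Let m := (size v).+1.

Definition clique_adj (x y : 'I_m * 'I_m) : bool :=
  clique_edge v (val x.1, val x.2) (val y.1, val y.2).

Lemma clique_adj_sym : symmetric clique_adj.
Proof.
suff sub x y : clique_adj x y -> clique_adj y x.
  by move=> x y; apply/idP/idP; apply: sub.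
case/and5P=> /= /eqP xy vx cxy cx cy.
by apply/and5P; split=> //=; rewrite -?xy // eq_sym.
Qed.

Lemma clique_adj_irrefl : irreflexive clique_adj.
Proof. by move=> x; rewrite /clique_adj /clique_edge /= !eqxx !andbF. Qed.

Definition clique_graph : sgraph := SGraph clique_adj_sym clique_adj_irrefl.

(** The machine lists the vertices in decreasing order, which is one of the orderings that
    [adjacency_code] allows. *)
Lemma adjacency_code_clique : adjacency_code clique_graph (matrix_word v).
Proof.
pose r := rev (enum 'I_m).
have vr : [seq val i | i <- r] = countdown v by rewrite map_rev val_enum_ord.
exists [seq (j, c) | j <- r, c <- r].
  apply: uniq_perm; rewrite ?enum_uniq //.
    by apply: allpairs_uniq => [||[? ?] [? ?] _ _ //]; rewrite rev_uniq enum_uniq.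
  move=> [j c]; rewrite mem_enum; apply/allpairsP.
  by exists (j, c); rewrite !mem_rev !mem_enum.
have -> : matrix_word v = [seq clique_edge v x y |
   x <- [seq (val x.1, val x.2) | x <- [seq (j, c) | j <- r, c <- r]],
   y <- [seq (val x.1, val x.2) | x <- [seq (j, c) | j <- r, c <- r]]].
  by rewrite map_allpairs /matrix_word /vertices -vr allpairs_mapl allpairs_mapr.
by rewrite allpairs_mapl allpairs_mapr.
Qed.

(** The neighbours of a clique vertex are the other vertices of its clique. *)
Lemma sum_clique_adj (f : 'I_m * 'I_m -> algC) (j c : 'I_m) :
  nth false (false :: v) j -> (c <= j)%N ->
  \sum_(x | clique_adj x (j, c)) f x =
  \sum_(i < m | (i <= j)%N) f (j, i) - f (j, c).
Proof.
move=> vj cj; rewrite [X in X - _](bigD1 c) //= [f _ + _]addrC addrK.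
transitivity (\sum_(i : 'I_m | i == j)
    \sum_(k : 'I_m | (k <= j)%N && (k != c)) f (i, k)).
  rewrite pair_big_dep /=; apply: eq_big => [[i k]|[i k] _] //=.
  rewrite /clique_adj /clique_edge /= !val_eqE.
  by have [->|] := eqVneq i j; rewrite /= ?vj ?cj ?andbT /= 1?andbC.
by rewrite big_pred1_eq.
Qed.

(** On the clique at [j] an eigenvector for [d > 0] is constant, which forces [d + 1 = j + 1];
    conversely the indicator of the clique at [d] is an eigenvector. *)
Lemma clique_eigenvalue (d : nat) : (0 < d)%N ->
  is_eigenvalue clique_graph d%:R = nth false (false :: v) d.
Proof.
have card_le (j : 'I_m) (a : algC) :
    \sum_(i < m | (i <= j)%N) a = j.+1%:R * a.
  by rewrite -(big_ord_widen _ (fun=> a) (ltn_ord j)) sumr_const card_ord mulr_natl.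
move=> d0; apply/idP/idP.
  case/is_eigenvalueP => f [[j c0] fx0] fA.
  have d_neq0 : (d%:R != 0 :> algC) by rewrite pnatr_eq0 -lt0n.
  (* A vertex outside all cliques is isolated, so the eigenvector would vanish there. *)
  have [vj cj] : nth false (false :: v) j /\ (c0 <= j)%N.
    have : \sum_(x | adj x ((j, c0) : clique_graph)) f x != 0.
      by rewrite fA mulf_neq0.
    case: (boolP (nth false (false :: v) j && (c0 <= j)%N)) => [/andP //|].
    move=> jc0; rewrite big_pred0 ?eqxx // => -[i c]; apply/negbTE.
    apply: contra jc0 => /and5P[/= /eqP ij vi _ _ cj].
    by move: vi; rewrite ij => ->.
  (* Adding [f (j, c)] to both sides of the eigenvector equation makes the right side independent of
     [c]. *)
  have fE (c : 'I_m) : (c <= j)%N ->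
      d.+1%:R * f (j, c) = \sum_(i < m | (i <= j)%N) f (j, i).
    move=> cj'; have := fA (j, c); rewrite [LHS]sum_clique_adj // => E.
    by rewrite -natr1 mulrDl mul1r -E subrK.
  have fc (c : 'I_m) : (c <= j)%N -> f (j, c) = f (j, c0).
    move=> cj'; apply: (@mulfI _ d.+1%:R); first by rewrite pnatr_eq0.
    by rewrite !fE.
  have := fE c0 cj; rewrite (eq_bigr (fun=> f (j, c0))); last by move=> i /fc.
  by rewrite card_le => /(mulIf fx0)/eqP; rewrite eqr_nat => /eqP[->].
move=> vd; have dm : (d < m)%N.
  rewrite ltnNge; apply/negP => md; move: vd.
  by rewrite nth_default.
pose j := Ordinal dm; apply/is_eigenvalueP.
exists (fun x : clique_graph => ((x.1 == j) && (x.2 <= d)%N)%:R).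
  by exists (j, j); rewrite /= eqxx leqnn oner_eq0.
move=> [i c] /=; have [/andP[/eqP-> cj]|icj] := boolP ((i == j) && (c <= d)%N).
  rewrite sum_clique_adj //= !eqxx cj /=.
  rewrite (eq_bigr (fun=> 1)); last by move=> k ->.
  by rewrite (card_le j) !mulr1 -natr1 addrK.
(* A vertex outside the clique has no neighbour in it: adjacency keeps the first coordinate and
   bounds [c] by it. *)
rewrite mulr0 big1 // => -[k c']; rewrite /clique_adj /clique_edge /=.
case/and5P=> /eqP ki _ _ _ ck.
case: eqP => //= kj; have ij : i = j by apply: val_inj; rewrite -kj.
by case/negP: icj; rewrite ij eqxx; move: ck; rewrite ij.
Qed.

End CliqueGraph.

(** * The reduction *)

Definition index_word (i : nat) : seq bool := rcons (nseq i true) false.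

Definition instance_word (i : nat) (x : seq bool) : seq bool :=
  index_word i ++ x ++ [:: true].

(** Reading with default [false] cannot see trailing zeros; the final [true] fixes the length. *)
Lemma rcons_true_inj (u u' : seq bool) :
  nth false (rcons u true) =1 nth false (rcons u' true) -> u = u'.
Proof.
have le_size (s t : seq bool) :
    nth false (rcons s true) =1 nth false (rcons t true) -> (size s <= size t)%N.
  move=> /(_ (size s)); rewrite nth_rcons ltnn eqxx => st.
  rewrite -ltnS -(size_rcons t true) ltnNge; apply/negP => ts.
  by rewrite nth_default in st.
move=> E; apply: (@rcons_injl _ true); apply: (@eq_from_nth _ false) => //.
rewrite !size_rcons; by congr _.+1; apply/eqP; rewrite eqn_leq !le_size.
Qed.

(** The run of ones ends at the first [false], so the code of the index is prefix-free. *)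
Lemma index_word_inj (i i' : nat) (x x' : seq bool) :
  index_word i ++ x = index_word i' ++ x' -> i = i' /\ x = x'.
Proof.
rewrite /index_word !cat_rcons.
by elim: i i' => [|i IH] [|i'] //= => [[->]|[] /IH[-> ->]].
Qed.

Lemma instance_word_inj (i i' : nat) (x x' : seq bool) :
  nth false (instance_word i x) =1 nth false (instance_word i' x') ->
  i = i' /\ x = x'.
Proof.
rewrite /instance_word !catA !cats1 => /rcons_true_inj; exact: index_word_inj.
Qed.

(** Position [d] of the word stands for the eigenvalue [d + 1]; the default [false] excludes integer
    eigenvalues beyond its length. *)
Definition eigenvalue_word (G : sgraph) (v : seq bool) : Prop :=
  forall d : nat, is_eigenvalue G d.+1%:R = nth false v d.

Definition in_encoded_language (G : sgraph) : Prop :=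
  exists i x, eigenvalue_word G (instance_word i x) /\ NP_language i x.

(** The property sees a graph only through its eigenvalues, which gives both isomorphism invariance
    and characterization by the spectrum. *)
Lemma in_encoded_language_congr (G H : sgraph) :
  (forall a, is_eigenvalue G a = is_eigenvalue H a) ->
  in_encoded_language G <-> in_encoded_language H.
Proof.
by move=> GH; split=> -[i [x [Ex Lx]]]; exists i, x; split=> // d;
   rewrite -Ex GH.
Qed.

Lemma eigenvalue_word_clique (v : seq bool) : eigenvalue_word (clique_graph v) v.
Proof. by move=> d; rewrite clique_eigenvalue. Qed.

Theorem theorem1 :
  exists P : sgraph -> Prop,
    graph_property P /\
    spectrally_characterizable P /\
    NP_hard (graph_problem P).
Proof.
exists in_encoded_language; split; [|split].
- by move=> G H GH; apply: in_encoded_language_congr => a; apply: isomorphic_eigenvalue.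
- by move=> G H GH; apply: in_encoded_language_congr => a; apply: spectrum_eigenvalue.
move=> L /NP_languageP[i Li].
exists (fun x => matrix_word (instance_word i x)).
  exact: polytime_matrix_word.
move=> x; rewrite Li; split=> [Lx|[G Gx [i' [x' [Ex' Lx']]]]].
  exists (clique_graph (instance_word i x)); first exact: adjacency_code_clique.
  by exists i, x; split=> //; apply: eigenvalue_word_clique.
(* [G] is any graph coded by the printed word, so its eigenvalues are compared through an
   isomorphism with the clique graph. *)
have iso : isomorphic G (clique_graph (instance_word i x)).
  apply: adjacency_code_isomorphic Gx (adjacency_code_clique _).
  exact: (ord0, ord0).
(* The eigenvalues spell both instance words, so index and input agree. *)
have [|-> -> //] := @instance_word_inj i i' x x'.
by move=> d; rewrite -Ex' (isomorphic_eigenvalue _ iso) eigenvalue_word_clique.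
Qed.
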